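(* Suppose that $\left(\frac jc\right)'(\kappa)>0$ for all $\kappa\in(0,\kappa_{max})$, that $\rho_c<\infty$, and that $k$ has an expansion $$\frac{k(r)}{r}=\frac n{\rho_c}-a\,r^q+o(r^q)\quad\text{as }r\to0,$$ with $q\ge1$ and $a\in\mathbb R$. (i) If $q<2$ and $a\ne0$, then $a>0$ and there is a critical exponent, given by $\beta=\frac1q$. (ii) If $q>2$, the critical exponent is given by $\beta=\frac12$. (iii) If $q=2$ and $a\ne-\frac{n^2}{\rho_c^3(n+2)}$, then $a>-\frac{n^2}{\rho_c^3(n+2)}$ and the critical exponent is given by $\beta=\frac12$. In the special case where $$\frac{k(r)}{r}=\frac n{\rho_c}+\frac{n^2}{\rho_c^3(n+2)}r^2-a_2\,r^p+o(r^p)\quad\text{as }r\to0,$$ with $2<p<4$ and $a_2\neq0$, then $a_2>0$ and the critical exponent is given by $\beta=\frac1p$.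
   Context: Let $n\ge2$. The functions $\nu:[0,\infty)\to[0,\infty)$ and $\tau:[0,\infty)\to(0,\infty)$ are such that $r\mapsto\nu(r)/r$ and $r\mapsto\tau(r)$ are Lipschitz and bounded. The function $k(r)=\nu(r)/\tau(r)$ is increasing; $\kappa_{max}=\lim_{r\to\infty}k(r)$ and $j:[0,\kappa_{max})\to[0,\infty)$ is the inverse function of $k$. Moreover $k$ is differentiable with Lipschitz derivative $k'$. Let $c(\kappa)=\frac{\int_0^\pi\cos\theta\,e^{\kappa\cos\theta}\sin^{n-2}\theta\,d\theta}{\int_0^\pi e^{\kappa\cos\theta}\sin^{n-2}\theta\,d\theta}$ for $\kappa\ge0$. Primes on $\frac jc$ denote derivatives with respect to $\kappa$. The critical density is $\rho_c=\lim_{\kappa\to0}\frac{j(\kappa)}{c(\kappa)}=\lim_{r\to0}\frac{n\,r}{k(r)}$. When $\left(\frac jc\right)'>0$ on $(0,\kappa_{max})$, for each $\rho>\rho_c$ the equation $\rho\,c(\kappa)=j(\kappa)$ has a unique positive solution $\kappa(\rho)$. The order parameter is $\alpha(\rho)=0$ for $\rho\le\rho_c$ and $\alpha(\rho)=c(\kappa(\rho))$ for $\rho>\rho_c$. One says that $\beta$ is the critical exponent of the phase transition if there exists $\alpha_0>0$ such that $\alpha(\rho)\sim\alpha_0(\rho-\rho_c)^\beta$ as $\rho\to\rho_c$, $\rho>\rho_c$. *)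

(* Defs.v *)
From Stdlib Require Import Reals.
From Coquelicot Require Import Coquelicot.

Local Open Scope R_scope.

(* Functions on an interval D of the line are represented by total functions
   R -> R; only their values on D matter. *)

Definition Rnonneg (r : R) : Prop := 0 <= r.
Definition Rpositive (r : R) : Prop := 0 < r.

Definition lipschitz_on (D : R -> Prop) (f : R -> R) : Prop :=
  exists L : R, forall x y : R, D x -> D y ->
    Rabs (f x - f y) <= L * Rabs (x - y).

Definition bounded_on (D : R -> Prop) (f : R -> R) : Prop :=
  exists M : R, forall x : R, D x -> Rabs (f x) <= M.

Definition increasing_on (D : R -> Prop) (f : R -> R) : Prop :=
  forall x y : R, D x -> D y -> x < y -> f x < f y.

(* Coquelicot's is_derive with the filter of neighbourhoods relative to D:
   at the endpoint 0 of [0, oo) this is the one-sided derivative. *)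
Definition is_derive_within (D : R -> Prop) (f : R -> R) (x l : R) : Prop :=
  filterdiff (K := R_AbsRing)
    (U := AbsRing_NormedModule R_AbsRing) (V := R_NormedModule)
    f (within D (locally x)) (fun y => scal y l).

Definition inverse_functions (A B : R -> Prop) (f g : R -> R) : Prop :=
  (forall x : R, A x -> B (f x) /\ g (f x) = x) /\
  (forall y : R, B y -> A (g y) /\ f (g y) = y).

Definition c (n : nat) (kappa : R) : R :=
  RInt (fun theta => cos theta * exp (kappa * cos theta) * sin theta ^ (n - 2))
    0 PI /
  RInt (fun theta => exp (kappa * cos theta) * sin theta ^ (n - 2)) 0 PI.

Definition positive_solution (n : nat) (j : R -> R) (kmax : Rbar)
    (rho kappa : R) : Prop :=
  0 < kappa /\ Rbar_lt kappa kmax /\ rho * c n kappa = j kappa.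

(* iota is a definite description: a junk value unless the solution exists
   and is unique. *)
Definition kappa_of (n : nat) (j : R -> R) (kmax : Rbar) (rho : R) : R :=
  iota (T := R_CompleteSpace) (positive_solution n j kmax rho).

Definition order_parameter (n : nat) (j : R -> R) (kmax : Rbar) (rho_c : R)
    (rho : R) : R :=
  if Rle_dec rho rho_c then 0 else c n (kappa_of n j kmax rho).

Definition is_critical_exponent (alpha : R -> R) (rho_c beta : R) : Prop :=
  exists alpha0 : R, 0 < alpha0 /\
    is_equiv (at_right rho_c) alpha
      (fun rho => alpha0 * Rpower (rho - rho_c) beta).

(* f r = g r + o(r^q) as r -> 0, r > 0. *)
Definition expansion_at_0 (f g : R -> R) (q : R) : Prop :=
  is_domin (at_right 0) (fun r => Rpower r q) (fun r => f r - g r).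

(* Main.v *)
Require Import Defs.
From Stdlib Require Import Reals Lra Lia ssreflect.
From Coquelicot Require Import Coquelicot.

Local Open Scope R_scope.

(* The moments of [cos] against [sin ^ (n - 2)] give
   [c x = x / n - x ^ 3 / (n ^ 2 (n + 2)) + O (x ^ 5)].  Put [r = j x], [u = k r / r];
   an expansion [u = n / rho_c + e r ^ 2 - a r ^ s + o (r ^ s)] with [s < 4] becomes
   [j x / c x = rho_c + A r ^ s + o (r ^ s)], where the [r ^ 2] contributions of [u] and
   of [c] are merged into [A] when [s = 2] and cancel for the critical value of [e].
   Since [j / c] increases from [rho_c], [A >= 0], and the solution of
   [j x / c x = rho] satisfies [r ~ ((rho - rho_c) / A) ^ (1 / s)] while
   [c x ~ r / rho_c]. *)

(** The expansion of [j] in powers of kappa is never computed. Everything is expanded in [r], the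
    variable of the hypothesis, through kappa = [k r], and carried back to kappa at the end by
    [r = j kappa]. The bound [s < 4] has two sources: [c x / x] is controlled only up to O(x^4), and
    in the critical case the leftover of the cancelled r^2 terms is itself of order r^4. All cases
    are one statement with different parameters: [s] is the order at which [j / c] leaves [rho_c],
    [e] the r^2 coefficient split off from [k r / r], [a] the coefficient of r^s that remains, and
    [B] the limit of the r^2 contributions divided by r^s. The assumptions on [a] or [a2] say
    exactly that the resulting coefficient is nonzero; combined with its nonnegativity they give the
    sign claim and the exponent together. *)

Lemma at_right_intro (x d : R) (P : R -> Prop) :
  0 < d -> (forall y, x < y < x + d -> P y) -> at_right x P.
Proof.
intros Hd HP. exists (mkposreal d Hd). intros y Hy Hxy. apply HP.
change (Rabs (y - x) < d) in Hy. apply Rabs_def2 in Hy. lra.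
Qed.

Lemma at_right_elim (x : R) (P : R -> Prop) :
  at_right x P -> exists d, 0 < d /\ forall y, x < y < x + d -> P y.
Proof.
intros [d Hd]. exists d. split. apply cond_pos. intros y Hy. apply Hd; try lra.
change (Rabs (y - x) < d). rewrite Rabs_pos_eq; lra.
Qed.

(** * Algebra of limits along an arbitrary filter, later [at_right 0] and [at_right rho_c] *)

Section Limits.

Context {T : Type} {F : (T -> Prop) -> Prop} {FF : Filter F}.

Lemma lim_eq (f : T -> R) (l l' : R) :
  filterlim f F (locally l) -> l = l' -> filterlim f F (locally l').
Proof. now intros H <-. Qed.

Lemma lim_const (a : R) : filterlim (fun _ : T => a) F (locally a).
Proof. apply filterlim_const. Qed.

Lemma lim_plus (f g : T -> R) (lf lg : R) :
  filterlim f F (locally lf) -> filterlim g F (locally lg) ->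
  filterlim (fun x => f x + g x) F (locally (lf + lg)).
Proof.
intros Hf Hg.
exact (filterlim_comp_2 f g Rplus Hf Hg (filterlim_plus (V := R_NormedModule) lf lg)).
Qed.

Lemma lim_mult (f g : T -> R) (lf lg : R) :
  filterlim f F (locally lf) -> filterlim g F (locally lg) ->
  filterlim (fun x => f x * g x) F (locally (lf * lg)).
Proof.
intros Hf Hg.
exact (filterlim_comp_2 f g Rmult Hf Hg (filterlim_mult (K := R_AbsRing) lf lg)).
Qed.

Lemma lim_continuous (f : T -> R) (g : R -> R) (l : R) :
  filterlim f F (locally l) -> continuous g l ->
  filterlim (fun x => g (f x)) F (locally (g l)).
Proof. intros Hf Hg. exact (filterlim_comp _ _ _ f g _ _ _ Hf Hg). Qed.

Lemma lim_opp (f : T -> R) (l : R) :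
  filterlim f F (locally l) -> filterlim (fun x => - f x) F (locally (- l)).
Proof.
intros Hf. apply (lim_continuous f Ropp); trivial.
apply (filterlim_opp (V := R_NormedModule)).
Qed.

Lemma lim_minus (f g : T -> R) (lf lg : R) :
  filterlim f F (locally lf) -> filterlim g F (locally lg) ->
  filterlim (fun x => f x - g x) F (locally (lf - lg)).
Proof. intros Hf Hg. apply lim_plus; trivial. now apply lim_opp. Qed.

Lemma lim_inv (f : T -> R) (l : R) :
  filterlim f F (locally l) -> l <> 0 -> filterlim (fun x => / f x) F (locally (/ l)).
Proof.
intros Hf Hl. apply (lim_continuous f Rinv); trivial. now apply continuous_Rinv.
Qed.

Lemma lim_pow (f : T -> R) (l : R) (m : nat) :
  filterlim f F (locally l) -> filterlim (fun x => f x ^ m) F (locally (l ^ m)).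
Proof.
intros Hf. induction m as [|m IH]; simpl. apply lim_const. now apply lim_mult.
Qed.

Lemma lim_Rpower (f : T -> R) (l s : R) :
  filterlim f F (locally l) -> 0 < l ->
  filterlim (fun x => Rpower (f x) s) F (locally (Rpower l s)).
Proof.
intros Hf Hl. unfold Rpower. apply (lim_continuous _ exp); [|apply continuous_exp].
apply lim_mult. apply lim_const. apply (lim_continuous f ln); trivial.
now apply continuous_ln.
Qed.

Lemma lim_eventually_pos (f : T -> R) (l : R) :
  filterlim f F (locally l) -> 0 < l -> F (fun x => 0 < f x).
Proof.
intros Hf Hl. apply (Hf (fun y => 0 < y)). now apply (open_gt 0).
Qed.

Lemma lim_at_right (f : T -> R) (l : R) :
  filterlim f F (locally l) -> F (fun x => l < f x) -> filterlim f F (at_right l).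
Proof.
intros Hf Hpos P HP. unfold filtermap.
apply (filter_imp (fun x => l < f x /\ (l < f x -> P (f x)))). tauto.
apply filter_and; trivial. exact (Hf _ HP).
Qed.

Lemma lim_0_bound (f g : T -> R) :
  F (fun x => Rabs (f x) <= g x) -> filterlim g F (locally 0) ->
  filterlim f F (locally 0).
Proof.
intros Hfg Hg. apply (filterlim_locally (U := R_UniformSpace)). intros eps.
apply (filterlim_locally (U := R_UniformSpace)) with (eps := eps) in Hg.
apply (filter_imp (fun x => Rabs (f x) <= g x /\ ball 0 eps (g x))).
- intros x [H1 H2]. change (Rabs (f x - 0) < eps). change (Rabs (g x - 0) < eps) in H2.
  apply Rabs_def2 in H2. rewrite Rminus_0_r. lra.
- now apply filter_and.
Qed.

Lemma domin_lim (f g : T -> R) :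
  F (fun x => 0 < f x) -> is_domin F f g ->
  filterlim (fun x => g x / f x) F (locally 0).
Proof.
intros Hf Hd. apply (filterlim_locally (U := R_UniformSpace)). intros eps.
(* Domination gives a non-strict bound while the ball is strict; half of [eps] bridges the two. *)
specialize (Hd (pos_div_2 eps)).
apply: filter_imp (filter_and _ _ Hf Hd). intros x [Hx H].
change (Rabs (g x) <= eps / 2 * Rabs (f x)) in H.
change (Rabs (g x / f x - 0) < eps).
rewrite Rminus_0_r Rabs_div; [|lra]. pose proof (Rabs_pos_eq (f x)).
pose proof (cond_pos eps).
apply Rle_lt_trans with (eps / 2); [|lra].
apply Rle_div_l; lra.
Qed.

Lemma lim_equiv (f g : T -> R) (l : R) :
  0 < l -> F (fun x => 0 < g x) ->
  filterlim (fun x => f x / g x) F (locally l) ->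
  is_equiv F f (fun x => l * g x).
Proof.
intros Hl Hg Hlim eps.
assert (He : 0 < eps * l) by (apply Rmult_lt_0_compat; trivial; apply cond_pos).
pose proof (proj1 (filterlim_locally (U := R_UniformSpace) _ _) Hlim (mkposreal _ He)) as Hb.
apply: filter_imp (filter_and _ _ Hg Hb). intros x [Hx H].
change (Rabs (f x / g x - l) < eps * l) in H.
change (Rabs (l * g x - f x) <= eps * Rabs (l * g x)).
replace (l * g x - f x) with (- (f x / g x - l) * g x) by (field; lra).
rewrite !Rabs_mult Rabs_Ropp (Rabs_pos_eq l) ?(Rabs_pos_eq (g x)); try lra.
rewrite -Rmult_assoc. apply Rmult_le_compat_r; lra.
Qed.

End Limits.

Lemma lim_ge {T : Type} {F : (T -> Prop) -> Prop} {FF : ProperFilter F}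
  (f : T -> R) (l a : R) :
  filterlim f F (locally l) -> F (fun x => a <= f x) -> a <= l.
Proof.
intros Hf Ha.
exact (filterlim_le (F := F) (fun _ => a) f (Finite a) (Finite l) Ha (lim_const a) Hf).
Qed.

Lemma lim_unique {T : Type} {F : (T -> Prop) -> Prop} {FF : ProperFilter F}
  (f : T -> R) (l l' : R) :
  filterlim f F (locally l) -> filterlim f F (locally l') -> l = l'.
Proof. exact (filterlim_locally_unique f l l'). Qed.

Lemma at_right_pos (x : R) : at_right x (fun y => x < y).
Proof. apply (at_right_intro x 1); intros; lra. Qed.

Lemma lim_id_right (x : R) : filterlim (fun y : R => y) (at_right x) (locally x).
Proof. intros P HP. now apply filter_le_within. Qed.

Lemma lim_Rpower_0 (s : R) :
  0 < s -> filterlim (fun r => Rpower r s) (at_right 0) (locally 0).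
Proof.
intros Hs. unfold Rpower.
apply (filterlim_comp _ _ _ (fun r => s * ln r) exp _ (Rbar_locally m_infty)).
- apply (filterlim_comp _ _ _ ln (fun y => s * y) _ (Rbar_locally m_infty)).
  apply is_lim_ln_0.
  assert (E : Rbar_mult s m_infty = m_infty).
  { simpl. destruct (Rle_dec 0 s); [|lra].
    destruct (Rle_lt_or_eq_dec 0 s r); trivial; lra. }
  rewrite -{2}E. apply (filterlim_Rbar_mult_l s m_infty).
- exact is_lim_exp_m.
Qed.

Ltac lim := repeat first
  [ eassumption | apply lim_const | apply lim_id_right | apply lim_minus | apply lim_plus | apply lim_opp
  | apply lim_pow | apply lim_mult ].

Lemma Rpower_pos (x s : R) : 0 < Rpower x s.
Proof. apply exp_pos. Qed.

(** * Expansion of [c] at the origin *)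

(** The mean value theorem between 0 and [x] gains one power of |x|. The constant 3 is kept, instead
    of the sharper 3 / (m + 1), so that the lemma can be iterated on Taylor remainders of [exp]: the
    derivative of each is the remainder one order lower, down to [exp] itself, bounded by e <= 3 on
    [-1, 1]. *)
Lemma mvt_bound (f g : R -> R) (m : nat) :
  (forall x, is_derive f x (g x)) -> f 0 = 0 ->
  (forall x, Rabs x <= 1 -> Rabs (g x) <= 3 * Rabs x ^ m) ->
  forall x, Rabs x <= 1 -> Rabs (f x) <= 3 * Rabs x ^ S m.
Proof.
intros Hd H0 Hg x Hx.
destruct (MVT_gen f 0 x g) as [y [Hy Heq]].
- intros; apply Hd.
- intros z _. apply continuity_pt_filterlim.
  apply (ex_derive_continuous (V := R_NormedModule)). now exists (g z).
- rewrite H0 !Rminus_0_r in Heq. rewrite Heq Rabs_mult.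
  assert (Hyx : Rabs y <= Rabs x).
  { revert Hy. unfold Rmin, Rmax. destruct (Rle_dec 0 x); intros Hy.
    rewrite !Rabs_pos_eq; lra. rewrite !Rabs_left1; lra. }
  replace (3 * Rabs x ^ S m) with ((3 * Rabs x ^ m) * Rabs x) by (simpl; ring).
  apply Rmult_le_compat_r. apply Rabs_pos.
  apply Rle_trans with (1 := Hg y ltac:(lra)).
  apply Rmult_le_compat_l. lra. apply pow_incr. split; trivial. apply Rabs_pos.
Qed.

Lemma exp_taylor4 (x : R) : Rabs x <= 1 ->
  Rabs (exp x - (1 + x + x ^ 2 / 2 + x ^ 3 / 6)) <= 3 * Rabs x ^ 4.
Proof.
revert x.
apply (mvt_bound _ (fun x => exp x - (1 + x + x ^ 2 / 2))).
{ intros; auto_derive; trivial; field. } { rewrite exp_0; field. }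
apply (mvt_bound _ (fun x => exp x - (1 + x))).
{ intros; auto_derive; trivial; field. } { rewrite exp_0; field. }
apply (mvt_bound _ (fun x => exp x - 1)).
{ intros; auto_derive; trivial; field. } { rewrite exp_0; field. }
apply (mvt_bound _ exp).
{ intros; auto_derive; trivial; field. } { rewrite exp_0; field. }
intros x Hx. rewrite Rabs_pos_eq. 2: left; apply exp_pos.
simpl. apply Rabs_le_between in Hx.
apply Rle_trans with (exp 1). 2: pose proof exp_le_3; lra.
destruct (Rle_lt_or_eq_dec x 1) as [H|H]; [lra| |subst; lra].
left; now apply exp_increasing.
Qed.

Lemma exp_taylor5 (x : R) : Rabs x <= 1 ->
  Rabs (exp x - (1 + x + x ^ 2 / 2 + x ^ 3 / 6 + x ^ 4 / 24)) <= 3 * Rabs x ^ 5.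
Proof.
revert x.
apply (mvt_bound _ (fun x => exp x - (1 + x + x ^ 2 / 2 + x ^ 3 / 6))).
{ intros; auto_derive; trivial; field. } { rewrite exp_0; field. }
apply exp_taylor4.
Qed.

Lemma two_le_INR (n : nat) : (2 <= n)%nat -> 2 <= INR n.
Proof. intros Hn. apply (le_INR 2) in Hn. simpl in Hn. lra. Qed.

(** Up to the factor 1 / m!, the Taylor coefficient of order [m] at 0 of the denominator of [c]; the
    numerator has the same coefficients with [m + 1] in place of [m] in the moment. Only ratios to
    [moment n 0] survive in [c]. *)
Definition moment (n m : nat) : R :=
  RInt (fun t => cos t ^ m * sin t ^ (n - 2)) 0 PI.

Lemma continuous_ex_derive (f : R -> R) (x : R) : ex_derive f x -> continuous f x.
Proof. apply (ex_derive_continuous (V := R_NormedModule)). Qed.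

Lemma ex_RInt_moment (n m : nat) :
  ex_RInt (fun t => cos t ^ m * sin t ^ (n - 2)) 0 PI.
Proof.
apply (ex_RInt_continuous (V := R_CompleteNormedModule)). intros t _.
apply continuous_ex_derive. now auto_derive.
Qed.

Lemma moment0_pos (n : nat) : 0 < moment n 0.
Proof.
unfold moment. apply RInt_gt_0. apply PI_RGT_0.
- intros x Hx. simpl. rewrite Rmult_1_l. apply pow_lt. apply sin_gt_0; lra.
- intros x _. apply continuous_ex_derive. now auto_derive.
Qed.

(* Integrate the derivative of [cos ^ (m + 1) * sin ^ (n - 1)]. *)
Lemma moment_rec (n m : nat) : (2 <= n)%nat ->
  (INR m + INR n) * moment n (S (S m)) = (INR m + 1) * moment n m.
Proof.
intros Hn. destruct n as [|[|N]]; [lia|lia|].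
unfold moment. replace (S (S N) - 2)%nat with N by lia.
assert (E : forall m, ex_RInt (fun t => cos t ^ m * sin t ^ N) 0 PI).
{ intros m'. generalize (ex_RInt_moment (S (S N)) m').
  now replace (S (S N) - 2)%nat with N by lia. }
assert (H : is_RInt (fun t =>
   minus (scal (INR m + INR (S (S N))) (cos t ^ S (S m) * sin t ^ N))
         (scal (INR m + 1) (cos t ^ m * sin t ^ N))) 0 PI 0).
{ apply is_RInt_ext with (fun t => - (INR m + 1) * cos t ^ m * sin t * sin t ^ S N
     + (INR N + 1) * cos t * sin t ^ N * cos t ^ S m).
  - intros t _.
    rewrite !S_INR.
    change (- (INR m + 1) * cos t ^ m * sin t * sin t ^ S N +
      (INR N + 1) * cos t * sin t ^ N * cos t ^ S m =
      (INR m + (INR N + 1 + 1)) * (cos t ^ S (S m) * sin t ^ N)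
      - (INR m + 1) * (cos t ^ m * sin t ^ N)).
    pose proof (sin2_cos2 t) as Hsc. unfold Rsqr in Hsc. simpl.
    (* Writing sin^2 as 1 - cos^2 leaves only the integrands of the moments [m] and [m + 2]. *)
    replace (- (INR m + 1) * cos t ^ m * sin t * (sin t * sin t ^ N))
      with (- (INR m + 1) * cos t ^ m * sin t ^ N * (1 - cos t * cos t)).
    ring. replace (1 - cos t * cos t) with (sin t * sin t) by lra. ring.
  (* Here [S N] is n - 1 >= 1, so the boundary terms vanish even for n = 2, where the weight sin^(n
     - 2) is 1 at both ends. *)
  - replace 0 with (minus (cos PI ^ S m * sin PI ^ S N) (cos 0 ^ S m * sin 0 ^ S N)) at 2.
    + apply (is_RInt_derive (V := R_CompleteNormedModule) (fun t => cos t ^ S m * sin t ^ S N)).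
      * intros t _. auto_derive; trivial.
        change (match m with 0%nat => 1 | S _ => INR m + 1 end) with (INR (S m)).
        change (match N with 0%nat => 1 | S _ => INR N + 1 end) with (INR (S N)).
        rewrite !S_INR. simpl. ring.
      * intros t _. apply continuous_ex_derive. auto_derive; trivial.
    + rewrite sin_PI sin_0. change (cos PI ^ S m * 0 ^ S N - cos 0 ^ S m * 0 ^ S N = 0).
      simpl. ring. }
apply (is_RInt_unique (V := R_CompleteNormedModule)) in H.
rewrite (RInt_minus (V := R_CompleteNormedModule)) in H;
  try apply (ex_RInt_scal (V := R_NormedModule)); auto.
rewrite !(RInt_scal (V := R_CompleteNormedModule)) in H; auto.
change ((INR m + INR (S (S N))) * RInt (fun t => cos t ^ S (S m) * sin t ^ N) 0 PI
  - (INR m + 1) * RInt (fun t => cos t ^ m * sin t ^ N) 0 PI = 0) in H.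
lra.
Qed.

(** The recursion preserves parity, so the odd moments need their own base case; here sin^(n - 1) /
    (n - 1) is a primitive that vanishes at both ends. *)
Lemma moment1 (n : nat) : (2 <= n)%nat -> moment n 1 = 0.
Proof.
intros Hn. destruct n as [|[|N]]; [lia|lia|].
unfold moment. replace (S (S N) - 2)%nat with N by lia.
apply (is_RInt_unique (V := R_CompleteNormedModule)).
apply is_RInt_ext with (fun t => / INR (S N) * (INR (S N) * cos t * sin t ^ N)).
- intros t _.
  change (/ INR (S N) * (INR (S N) * cos t * sin t ^ N) = cos t ^ 1 * sin t ^ N).
  rewrite pow_1. field. apply not_0_INR. lia.
- replace 0 with (minus (/ INR (S N) * sin PI ^ S N) (/ INR (S N) * sin 0 ^ S N)) at 2.
  + apply (is_RInt_derive (V := R_CompleteNormedModule) (fun t => / INR (S N) * sin t ^ S N)).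
    * intros t _. auto_derive; trivial.
      change (match N with 0%nat => 1 | S _ => INR N + 1 end) with (INR (S N)).
      rewrite -!Rmult_assoc !Rmult_1_r. change (Nat.pred (S N)) with N. ring.
    * intros t _. apply continuous_ex_derive. auto_derive; trivial.
  + rewrite sin_PI sin_0. change (/ INR (S N) * 0 ^ S N - / INR (S N) * 0 ^ S N = 0). ring.
Qed.

Lemma moment_odd (n m : nat) : (2 <= n)%nat -> moment n (2 * m + 1) = 0.
Proof.
intros Hn. induction m as [|m IH]. now apply moment1.
replace (2 * S m + 1)%nat with (S (S (2 * m + 1))) by lia.
pose proof (moment_rec n (2 * m + 1) Hn) as H. rewrite IH in H.
apply le_INR in Hn. simpl (INR 2) in Hn. pose proof (pos_INR (2 * m + 1)).
apply Rmult_eq_reg_l with (INR (2 * m + 1) + INR n); lra.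
Qed.

Lemma moment2 (n : nat) : (2 <= n)%nat -> moment n 2 = moment n 0 / INR n.
Proof.
intros Hn. pose proof (moment_rec n 0 Hn) as H. simpl (INR 0) in H.
apply le_INR in Hn. simpl (INR 2) in Hn.
apply Rmult_eq_reg_l with (INR n); try lra. field_simplify; lra.
Qed.

Lemma moment4 (n : nat) : (2 <= n)%nat ->
  moment n 4 = 3 * moment n 0 / (INR n * (INR n + 2)).
Proof.
intros Hn. pose proof (moment_rec n 2 Hn) as H. rewrite (moment2 n Hn) in H.
simpl (INR 2) in H.
apply le_INR in Hn. simpl (INR 2) in Hn.
apply Rmult_eq_reg_l with (INR n + 2); try lra.
replace ((INR n + 2) * moment n 4) with ((1 + 1 + INR n) * moment n 4) by ring.
rewrite H. field; lra.
Qed.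

Lemma is_RInt_moment (n m : nat) :
  is_RInt (fun t => cos t ^ m * sin t ^ (n - 2)) 0 PI (moment n m).
Proof.
apply (RInt_correct (V := R_CompleteNormedModule)). apply ex_RInt_moment.
Qed.

Lemma is_RInt_Rplus (f g : R -> R) (a b If Ig : R) :
  is_RInt f a b If -> is_RInt g a b Ig -> is_RInt (fun x => f x + g x) a b (If + Ig).
Proof. exact (is_RInt_plus (V := R_NormedModule) f g a b If Ig). Qed.

Lemma is_RInt_Rscal (f : R -> R) (a b l If : R) :
  is_RInt f a b If -> is_RInt (fun x => l * f x) a b (l * If).
Proof. exact (is_RInt_scal (V := R_NormedModule) f a b l If). Qed.

Definition c_num (n : nat) (x : R) : R :=
  RInt (fun t => cos t * exp (x * cos t) * sin t ^ (n - 2)) 0 PI.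

Definition c_den (n : nat) (x : R) : R :=
  RInt (fun t => exp (x * cos t) * sin t ^ (n - 2)) 0 PI.

Lemma RInt_close (f g : R -> R) (a b Ig M : R) :
  a <= b -> (forall t, ex_derive f t) -> is_RInt g a b Ig ->
  (forall t, Rabs (f t - g t) <= M) ->
  Rabs (RInt f a b - Ig) <= (b - a) * M.
Proof.
intros Hab Hf Hg HM.
assert (Ef : ex_RInt f a b).
{ apply (ex_RInt_continuous (V := R_CompleteNormedModule)). intros t _.
  now apply continuous_ex_derive. }
assert (H : is_RInt (fun t => f t - g t) a b (RInt f a b - Ig)).
{ apply (is_RInt_minus (V := R_NormedModule) f g); trivial.
  now apply (RInt_correct (V := R_CompleteNormedModule)). }
rewrite -(is_RInt_unique (V := R_CompleteNormedModule) _ _ _ _ H).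
apply abs_RInt_le_const; auto. now eexists; exact H.
Qed.

Lemma Rabs_cos_le_1 (t : R) : Rabs (cos t) <= 1.
Proof. apply Rabs_le. pose proof (COS_bound t). lra. Qed.

Lemma Rabs_sin_pow_le_1 (t : R) (m : nat) : Rabs (sin t ^ m) <= 1.
Proof.
rewrite -RPow_abs. rewrite -(pow1 m). apply pow_incr. split. apply Rabs_pos.
apply Rabs_le. pose proof (SIN_bound t). lra.
Qed.

Lemma Rabs_mul_cos (x t : R) : 0 <= x -> Rabs (x * cos t) <= x.
Proof.
intros Hx. rewrite Rabs_mult (Rabs_pos_eq x) //. pose proof (Rabs_cos_le_1 t). nra.
Qed.

Lemma Rabs_mul_le_bound (a b M : R) : Rabs a <= M -> Rabs b <= 1 -> Rabs (a * b) <= M.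
Proof.
intros Ha Hb. rewrite Rabs_mult. pose proof (Rabs_pos a). pose proof (Rabs_pos b). nra.
Qed.

(** The Taylor polynomial of the exponential is integrated term by term: even powers of [x] meet odd
    moments and vanish, and (x^3 / 6) [moment n 4] gives the cubic coefficient. One order more than
    for the denominator is kept because the numerator is later divided by [x]. *)
Lemma c_num_expansion (n : nat) (x : R) : (2 <= n)%nat -> 0 <= x <= 1 ->
  Rabs (c_num n x - moment n 0 * (x / INR n + x ^ 3 / (2 * (INR n * (INR n + 2)))))
    <= PI * (3 * x ^ 5).
Proof.
intros Hn Hx.
assert (H1 := moment_odd n 0 Hn). assert (H3 := moment_odd n 1 Hn).
assert (H5 := moment_odd n 2 Hn). simpl in H1, H3, H5.
assert (H2 := moment2 n Hn). assert (H4 := moment4 n Hn).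
assert (Hn' := two_le_INR n Hn).
replace (moment n 0 * (x / INR n + x ^ 3 / (2 * (INR n * (INR n + 2))))) with
  (1 * moment n 1 + (x * moment n 2 + (x ^ 2 / 2 * moment n 3 +
   (x ^ 3 / 6 * moment n 4 + x ^ 4 / 24 * moment n 5)))).
2: { rewrite H1 H2 H3 H4 H5. field. lra. }
replace PI with (PI - 0) at 1 by ring.
unfold c_num. eapply RInt_close.
- pose proof PI_RGT_0; lra.
- intros t. auto_derive; trivial.
(* The comparison function is read off from the sum of moments: it is the Taylor polynomial times
   cos and the weight. *)
- repeat eapply is_RInt_Rplus; apply is_RInt_Rscal; apply is_RInt_moment.
- intros t. simpl.
  match goal with |- Rabs ?e <= _ => replace e with
    ((exp (x * cos t) - (1 + x * cos t + (x * cos t) ^ 2 / 2 + (x * cos t) ^ 3 / 6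
       + (x * cos t) ^ 4 / 24)) * cos t * sin t ^ (n - 2)) by field end.
  apply Rabs_mul_le_bound. 2: apply Rabs_sin_pow_le_1.
  apply Rabs_mul_le_bound. 2: apply Rabs_cos_le_1.
  pose proof (Rabs_mul_cos x t (proj1 Hx)) as Hc.
  eapply Rle_trans. apply exp_taylor5. lra.
  apply Rmult_le_compat_l. lra. apply (pow_incr _ _ 5). split; trivial. apply Rabs_pos.
Qed.

Lemma c_den_expansion (n : nat) (x : R) : (2 <= n)%nat -> 0 <= x <= 1 ->
  Rabs (c_den n x - moment n 0 * (1 + x ^ 2 / (2 * INR n))) <= PI * (3 * x ^ 4).
Proof.
intros Hn Hx.
assert (H1 := moment_odd n 0 Hn). assert (H3 := moment_odd n 1 Hn). simpl in H1, H3.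
assert (H2 := moment2 n Hn).
assert (Hn' := two_le_INR n Hn).
replace (moment n 0 * (1 + x ^ 2 / (2 * INR n))) with
  (1 * moment n 0 + (x * moment n 1 + (x ^ 2 / 2 * moment n 2 + x ^ 3 / 6 * moment n 3))).
2: { rewrite H1 H2 H3. field. lra. }
replace PI with (PI - 0) at 1 by ring.
unfold c_den. eapply RInt_close.
- pose proof PI_RGT_0; lra.
- intros t. auto_derive; trivial.
- repeat eapply is_RInt_Rplus; apply is_RInt_Rscal; apply is_RInt_moment.
- intros t. simpl.
  match goal with |- Rabs ?e <= _ => replace e with
    ((exp (x * cos t) - (1 + x * cos t + (x * cos t) ^ 2 / 2 + (x * cos t) ^ 3 / 6))
      * sin t ^ (n - 2)) by field end.
  apply Rabs_mul_le_bound. 2: apply Rabs_sin_pow_le_1.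
  pose proof (Rabs_mul_cos x t (proj1 Hx)) as Hc.
  eapply Rle_trans. apply exp_taylor4. lra.
  apply Rmult_le_compat_l. lra. apply (pow_incr _ _ 4). split; trivial. apply Rabs_pos.
Qed.

Lemma Rpower_split (x a b : R) : Rpower x a = Rpower x b * Rpower x (a - b).
Proof. rewrite -Rpower_plus. f_equal. ring. Qed.

(** Dividing the two expansions gives the x^2 coefficient 1 / (2n(n + 2)) - 1 / (2n^2) = - 1 / (n^2
    (n + 2)). Both errors are O(x^4) once the numerator is divided by [x], so after division by x^s
    they are O(x^(4 - s)). *)
Lemma c_expansion (n : nat) (s : R) : (2 <= n)%nat -> s < 4 ->
  filterlim
    (fun x => (c n x / x - (1 / INR n - x ^ 2 / (INR n ^ 2 * (INR n + 2)))) / Rpower x s)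
    (at_right 0) (locally 0).
Proof.
intros Hn Hs.
assert (Hn' := two_le_INR n Hn).
pose proof (moment0_pos n) as HW. set (W := moment n 0) in *.
assert (Hx1 : at_right 0 (fun x => 0 < x <= 1)).
{ apply (at_right_intro 0 1). lra. intros; lra. }
assert (Hnum : filterlim (fun x => (c_num n x - W * (x / INR n + x ^ 3 / (2 * (INR n * (INR n + 2)))))
     / x / Rpower x s) (at_right 0) (locally 0)).
{ apply lim_0_bound with (fun x => PI * 3 * Rpower x (4 - s)).
  - apply: filter_imp Hx1. intros x Hx.
    pose proof (Rpower_pos x s).
    rewrite !Rabs_div; try lra. rewrite (Rabs_pos_eq x); [|lra].
    rewrite (Rabs_pos_eq (Rpower x s)); [|lra].
    apply Rle_div_l; trivial. apply Rle_div_l; [lra|].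
    eapply Rle_trans. apply c_num_expansion; trivial; lra.
    replace (PI * 3 * Rpower x (4 - s) * Rpower x s * x)
      with (PI * 3 * (Rpower x s * Rpower x (4 - s)) * x) by ring.
    rewrite -Rpower_split. replace 4 with (INR 4) by (simpl; ring).
    rewrite Rpower_pow; [|lra]. simpl; lra.
  - eapply lim_eq. apply lim_mult. apply lim_const. apply lim_Rpower_0. lra. ring. }
assert (Hden : filterlim (fun x => (c_den n x - W * (1 + x ^ 2 / (2 * INR n)))
     / Rpower x s) (at_right 0) (locally 0)).
{ apply lim_0_bound with (fun x => PI * 3 * Rpower x (4 - s)).
  - apply: filter_imp Hx1. intros x Hx.
    pose proof (Rpower_pos x s).
    rewrite Rabs_div; try lra.
    rewrite (Rabs_pos_eq (Rpower x s)); [|lra].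
    apply Rle_div_l; trivial.
    eapply Rle_trans. apply c_den_expansion; trivial; lra.
    replace (PI * 3 * Rpower x (4 - s) * Rpower x s)
      with (PI * 3 * (Rpower x s * Rpower x (4 - s))) by ring.
    rewrite -Rpower_split. replace 4 with (INR 4) by (simpl; ring).
    rewrite Rpower_pow; [|lra]. simpl; lra.
  - eapply lim_eq. apply lim_mult. apply lim_const. apply lim_Rpower_0. lra. ring. }
assert (Hden0 : filterlim (c_den n) (at_right 0) (locally W)).
{ apply (filterlim_ext_loc (fun x => (c_den n x - W * (1 + x ^ 2 / (2 * INR n)))
    + W * (1 + x ^ 2 * / (2 * INR n)))).
  - apply: filter_imp Hx1. intros x Hx. simpl. field. lra.
  - eapply lim_eq. apply lim_plus.
    + apply lim_0_bound with (fun x => PI * (3 * x ^ 4)).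
      * apply: filter_imp Hx1. intros x Hx. apply c_den_expansion; trivial; lra.
      * eapply lim_eq. lim. ring.
    + lim.
    + simpl. ring. }
assert (H4 := lim_Rpower_0 (4 - s) ltac:(lra)).
(* With P = 1/n - x^2 / (n^2 (n + 2)), this is [c_num / x] - P [c_den], over x^s and then over
   [c_den]. The polynomial parts cancel up to x^2 and leave W x^4 / (2 n^3 (n + 2)), the origin of
   the last summand. *)
apply (filterlim_ext_loc (fun x =>
  ((c_num n x - W * (x / INR n + x ^ 3 / (2 * (INR n * (INR n + 2))))) / x / Rpower x s
   - (1 / INR n - x ^ 2 * / (INR n ^ 2 * (INR n + 2))) *
     ((c_den n x - W * (1 + x ^ 2 / (2 * INR n))) / Rpower x s)
   + W * / (2 * INR n ^ 3 * (INR n + 2)) * Rpower x (4 - s)) * / c_den n x)).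
- apply: filter_imp (filter_and _ _ Hx1 (lim_eventually_pos _ _ Hden0 HW)).
  intros x [Hx Hd].
  change (c n x) with (c_num n x / c_den n x).
  pose proof (Rpower_pos x s).
  assert (E : Rpower x (4 - s) = x ^ 4 / Rpower x s).
  { rewrite -(Rpower_pow 4 x); [|lra]. replace (INR 4) with 4 by (simpl; ring).
    rewrite (Rpower_split x 4 s). field. lra. }
  rewrite E. field. lra.
- eapply lim_eq. apply lim_mult. lim. apply lim_inv; [eassumption|lra].
  ring.
Qed.

Lemma c_equivalent (n : nat) : (2 <= n)%nat ->
  filterlim (fun x => c n x / x) (at_right 0) (locally (1 / INR n)).
Proof.
intros Hn. pose proof (c_expansion n 0 Hn ltac:(lra)) as H.
apply (filterlim_ext_loc (fun x =>
   (c n x / x - (1 / INR n - x ^ 2 / (INR n ^ 2 * (INR n + 2)))) / Rpower x 0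
   + (1 / INR n - x ^ 2 * / (INR n ^ 2 * (INR n + 2))))).
- apply: filter_imp (at_right_pos 0). intros x Hx. rewrite Rpower_O; trivial.
  unfold Rdiv at 1. rewrite Rinv_1. unfold Rdiv. ring.
- eapply lim_eq. lim. simpl. ring.
Qed.

(** * The solution of [rho * c kappa = j kappa] just above the critical density *)

Lemma at_right_lt_Rbar (b : Rbar) : Rbar_lt 0 b -> at_right 0 (fun x => Rbar_lt x b).
Proof.
intros Hb. destruct b as [b| |]; simpl in *; [|now apply (at_right_intro 0 1); [lra|]|easy].
apply (at_right_intro 0 b); trivial. intros y Hy. lra.
Qed.

Lemma ratio_increasing (f : R -> R) (b : Rbar) :
  (forall x, 0 < x -> Rbar_lt x b -> ex_derive f x /\ 0 < Derive f x) ->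
  forall x y, 0 < x -> x < y -> Rbar_lt y b -> f x < f y.
Proof.
intros Hd. apply (incr_function f 0 b (Derive f)).
- intros x Hx Hxb. apply Derive_correct. now apply Hd.
- intros x Hx Hxb. now apply Hd.
Qed.

(** Passing to the limit gives only [l <= f (x / 2)]; strict growth from [x / 2] to [x] restores
    strictness. *)
Lemma ratio_gt_limit (f : R -> R) (b : Rbar) (l : R) :
  (forall x, 0 < x -> Rbar_lt x b -> ex_derive f x /\ 0 < Derive f x) ->
  filterlim f (at_right 0) (locally l) ->
  forall x, 0 < x -> Rbar_lt x b -> l < f x.
Proof.
intros Hd Hl x Hx Hxb. pose proof (ratio_increasing f b Hd) as Hf.
assert (Hx2 : Rbar_lt (x / 2) b) by (apply Rbar_lt_trans with x; simpl; trivial; lra).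
apply Rle_lt_trans with (f (x / 2)). 2: apply Hf; trivial; lra.
apply Ropp_le_cancel. apply (lim_ge (F := at_right 0) (fun y => - f y)).
- now apply lim_opp.
- apply (at_right_intro 0 (x / 2)); [lra|]. intros y Hy.
  apply Ropp_le_contravar. left. apply Hf; trivial; lra.
Qed.

(** The definite description carries information only once existence and uniqueness are known. For
    [rho] between [rho_c] and [f y], with [y <= e], the intermediate value theorem yields a solution
    below [y], and strict monotonicity of [j / c] makes it the only one; hence the solution tends to
    0 as [rho] decreases to [rho_c]. *)
Lemma kappa_of_small (n : nat) (j : R -> R) (kmax : Rbar) (rho_c : R) :
  0 <= rho_c -> Rbar_lt 0 kmax ->
  (forall x, 0 < x -> Rbar_lt x kmax -> 0 < j x) ->
  (forall x, 0 < x -> Rbar_lt x kmax ->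
     ex_derive (fun x => j x / c n x) x /\ 0 < Derive (fun x => j x / c n x) x) ->
  filterlim (fun x => j x / c n x) (at_right 0) (locally rho_c) ->
  forall e, 0 < e -> at_right rho_c (fun rho =>
    positive_solution n j kmax rho (kappa_of n j kmax rho) /\ kappa_of n j kmax rho < e).
Proof.
intros Hrc Hkmax Hj Hd Hl e He.
set (f := fun x => j x / c n x) in *.
assert (Hmono := ratio_increasing f kmax Hd).
assert (Hcont : forall x, 0 < x -> Rbar_lt x kmax -> continuity_pt f x).
{ intros x Hx Hxk. apply continuity_pt_filterlim. apply continuous_ex_derive. now apply Hd. }
assert (He' : exists y, 0 < y <= e /\ Rbar_lt y kmax).
{ destruct (at_right_elim _ _ (at_right_lt_Rbar kmax Hkmax)) as [d [Hd0 Hdk]].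
  exists (Rmin e (d / 2)). split. split. apply Rmin_glb_lt; lra. apply Rmin_l.
  apply Hdk. split. apply Rmin_glb_lt; lra. pose proof (Rmin_r e (d / 2)). lra. }
destruct He' as [y [Hy Hyk]].
pose proof (ratio_gt_limit f kmax rho_c Hd Hl y (proj1 Hy) Hyk) as Hfy.
apply (at_right_intro rho_c (f y - rho_c)); [lra|]. intros rho Hrho.
assert (Hx0 : exists x, 0 < x < y /\ f x < rho).
{ assert (Hlt : at_right 0 (fun x => f x < rho)).
  { apply (Hl (fun z => z < rho)). apply (open_lt rho). lra. }
  destruct (at_right_elim _ _ Hlt) as [d [Hd0 Hdx]].
  assert (0 < Rmin (y / 2) (d / 2)) by (apply Rmin_glb_lt; lra).
  pose proof (Rmin_l (y / 2) (d / 2)). pose proof (Rmin_r (y / 2) (d / 2)).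
  exists (Rmin (y / 2) (d / 2)). split. lra. apply Hdx. lra. }
destruct Hx0 as [x0 [Hx0 Hfx0]].
assert (Hx0k : Rbar_lt x0 kmax) by (apply Rbar_lt_trans with y; simpl; trivial; lra).
destruct (IVT_Rbar_incr f x0 y (f x0) (f y) rho) as [x [Hx0x [Hxy Hfx]]].
- apply is_lim_continuity. apply Hcont; trivial; lra.
- apply is_lim_continuity. apply Hcont; trivial; lra.
- intros x Hx Hxy. simpl in Hx, Hxy. apply Hcont. lra.
  apply Rbar_lt_trans with y; simpl; trivial; lra.
- simpl; lra.
- simpl; lra.
- simpl in Hx0x, Hxy.
  assert (Hxk : Rbar_lt x kmax) by (apply Rbar_lt_trans with y; simpl; trivial; lra).
  assert (Hsol : positive_solution n j kmax rho x).
  { split. lra. split; trivial. rewrite -Hfx. unfold f. field.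
    (* If [c n x] were 0, the quotient would be 0 by the convention on inverses, against
       [rho > rho_c >= 0]. *)
    intros Hc. unfold f in Hfx. rewrite Hc /Rdiv Rinv_0 in Hfx. lra. }
  assert (Hkx : kappa_of n j kmax rho = x).
  { apply (iota_unique (V := R_CompleteNormedModule)); trivial.
    intros z [Hz [Hzk Hzr]].
    assert (Hfz : f z = rho).
    { pose proof (Hj z Hz Hzk). unfold f. rewrite -Hzr. field. intros Hc.
      rewrite Hc in Hzr. lra. }
    destruct (Rtotal_order z x) as [H|[H|H]]; trivial; exfalso.
    - pose proof (Hmono z x Hz H Hxk). lra.
    - pose proof (Hmono x z ltac:(lra) H Hzk). lra. }
  rewrite Hkx. split; trivial. lra.
Qed.

Lemma order_parameter_exponent (n : nat) (j : R -> R) (kmax : Rbar) (rho_c s A : R) :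
  0 < rho_c -> 0 < s -> 0 < A ->
  (forall x, 0 < x -> Rbar_lt x kmax -> 0 < j x) ->
  (forall e, 0 < e -> at_right rho_c (fun rho =>
    positive_solution n j kmax rho (kappa_of n j kmax rho) /\ kappa_of n j kmax rho < e)) ->
  filterlim (fun x => j x / c n x) (at_right 0) (locally rho_c) ->
  filterlim (fun x => (j x / c n x - rho_c) / Rpower (j x) s) (at_right 0) (locally A) ->
  is_critical_exponent (order_parameter n j kmax rho_c) rho_c (1 / s).
Proof.
intros Hrc Hs HA Hj Hsol Hl HlA.
pose proof (Rpower_pos A (1 / s)) as HAs.
set (K := kappa_of n j kmax) in *.
assert (HK : filterlim K (at_right rho_c) (at_right 0)).
{ apply lim_at_right.
  - apply (filterlim_locally (U := R_UniformSpace)). intros e.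
    apply: filter_imp (Hsol e (cond_pos e)). intros rho [[H _] He].
    change (Rabs (K rho - 0) < e). rewrite Rminus_0_r Rabs_pos_eq; lra.
  - apply: filter_imp (Hsol 1 Rlt_0_1). now intros rho [[H _] _]. }
pose proof (filterlim_comp _ _ _ K _ _ _ _ HK Hl) as Hl'.
pose proof (filterlim_comp _ _ _ K _ _ _ _ HK HlA) as HlA'. cbv beta in Hl', HlA'.
exists (/ rho_c * / Rpower A (1 / s)). split.
{ apply Rmult_lt_0_compat; apply Rinv_0_lt_compat; trivial. }
apply lim_equiv.
- apply Rmult_lt_0_compat; apply Rinv_0_lt_compat; trivial.
- apply filter_forall. intros. apply Rpower_pos.
(* This is an exact formula for the quotient: with [r = j (K rho)], one has c = r / rho and r =
   (r^s)^(1/s), so c / (rho - rho_c)^(1/s) is 1 / rho times the inverse of ((rho - rho_c) /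
   r^s)^(1/s), and both factors have limits. *)
- apply (filterlim_ext_loc (fun rho => / (j (K rho) / c n (K rho)) *
    / Rpower ((j (K rho) / c n (K rho) - rho_c) / Rpower (j (K rho)) s) (1 / s))).
  2: { apply lim_mult; apply lim_inv; try lra; trivial. now apply lim_Rpower. }
  apply: filter_imp (filter_and _ _ (at_right_pos rho_c) (Hsol 1 Rlt_0_1)).
  intros rho [Hrho [[HK0 [HKm HKr]] _]].
  unfold order_parameter. destruct (Rle_dec rho rho_c); [lra|].
  change (kappa_of n j kmax rho) with (K rho).
  pose proof (Hj _ HK0 HKm) as Hjp.
  assert (Hc : c n (K rho) <> 0) by (intros Hc; rewrite Hc in HKr; lra).
  replace (j (K rho) / c n (K rho)) with rho by (rewrite -HKr; field; trivial).
  assert (E : Rpower (rho - rho_c) (1 / s) =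
    Rpower ((rho - rho_c) / Rpower (j (K rho)) s) (1 / s) * j (K rho)).
  { assert (E1 : j (K rho) = Rpower (Rpower (j (K rho)) s) (1 / s)).
    { rewrite Rpower_mult. replace (s * (1 / s)) with 1 by (field; lra). now rewrite Rpower_1. }
    rewrite {2}E1 Rpower_mult_distr. f_equal. field.
    apply Rgt_not_eq, Rpower_pos.
    apply Rdiv_lt_0_compat. lra. apply Rpower_pos. apply Rpower_pos. }
  rewrite E.
  replace (c n (K rho)) with (j (K rho) / rho) by (rewrite -HKr; field; lra).
  pose proof (Rpower_pos ((rho - rho_c) / Rpower (j (K rho)) s) (1 / s)).
  field. repeat split; lra.
Qed.

(** * Expansion of the ratio [j / c] *)

Lemma k_at_right_0 (k : R -> R) (u : R) :
  at_right 0 (fun r => 0 < k r) ->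
  filterlim (fun r => k r / r) (at_right 0) (locally u) ->
  filterlim k (at_right 0) (at_right 0).
Proof.
intros Hk Hu. apply lim_at_right; trivial.
apply (filterlim_ext_loc (fun r => k r / r * r)).
- apply: filter_imp (at_right_pos 0). intros r Hr. field. lra.
- eapply lim_eq. lim. ring.
Qed.

(* With [u = k r / r], [m = c (k r) / k r] the ratio is [1 / (u m)], and
   [1 - rho_c u m] is expanded using [m = 1/n - (u r)^2 / (n^2 (n + 2)) + o(r^s)]. *)
Lemma ratio_expansion (n : nat) (k : R -> R) (rho_c s e a B : R) :
  (2 <= n)%nat -> 0 < rho_c -> s < 4 ->
  at_right 0 (fun r => 0 < k r) ->
  filterlim (fun r => k r / r) (at_right 0) (locally (INR n / rho_c)) ->
  filterlim (fun r => (k r / r - (INR n / rho_c + e * r ^ 2)) / Rpower r s)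
    (at_right 0) (locally (- a)) ->
  filterlim (fun r => (rho_c / (INR n ^ 2 * (INR n + 2)) * (k r / r) ^ 3
      - rho_c / INR n * e) * Rpower r (2 - s)) (at_right 0) (locally B) ->
  filterlim (fun r => (r / c n (k r) - rho_c) / Rpower r s) (at_right 0)
    (locally (rho_c * (rho_c * a / INR n + B))).
Proof.
intros Hn Hrc Hs Hk Hu Hw HB.
assert (Hn' := two_le_INR n Hn).
pose proof (k_at_right_0 k _ Hk Hu) as Hk0.
pose proof (filterlim_comp _ _ _ k _ _ _ _ Hk0 (c_expansion n s Hn Hs)) as Hd.
pose proof (filterlim_comp _ _ _ k _ _ _ _ Hk0 (c_equivalent n Hn)) as Hm.
cbv beta in Hd, Hm.
assert (Hu0 : 0 < INR n / rho_c) by (apply Rdiv_lt_0_compat; lra).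
pose proof (lim_Rpower (fun r => k r / r) _ s Hu Hu0) as Hus.
assert (Hm0 : 0 < 1 / INR n) by (apply Rdiv_lt_0_compat; lra).
(* The numerator (1 - rho_c u m) / r^s splits into the deviation of [u], the r^2 contributions with
   limit [B], and the remainder of [c], rescaled by (k r)^s = u^s r^s and tending to 0. The
   denominator u m tends to 1 / rho_c, hence the outer factor [rho_c] of the limit. *)
apply (filterlim_ext_loc (fun r =>
  (- (rho_c * / INR n) * ((k r / r - (INR n / rho_c + e * r ^ 2)) / Rpower r s)
   + (rho_c / (INR n ^ 2 * (INR n + 2)) * (k r / r) ^ 3 - rho_c / INR n * e) * Rpower r (2 - s)
   - rho_c * (k r / r) * ((c n (k r) / k r - (1 / INR n - k r ^ 2 / (INR n ^ 2 * (INR n + 2))))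
        / Rpower (k r) s) * Rpower (k r / r) s) * / (k r / r * (c n (k r) / k r)))).
- apply: filter_imp (filter_and _ _ (filter_and _ _ (at_right_pos 0) Hk)
    (lim_eventually_pos _ _ Hm Hm0)).
  intros r [[Hr Hkr] Hmr]. simpl in Hmr.
  assert (Hc : c n (k r) <> 0).
  { intros Hc. rewrite Hc /Rdiv Rmult_0_l in Hmr. lra. }
  assert (E : Rpower (k r) s = Rpower (k r / r) s * Rpower r s).
  { rewrite Rpower_mult_distr //. f_equal. field. lra. now apply Rdiv_lt_0_compat. }
  assert (E2 : Rpower r (2 - s) = r ^ 2 / Rpower r s).
  { rewrite -(Rpower_pow 2 r) //. replace (INR 2) with 2 by (simpl; ring).
    rewrite (Rpower_split r 2 s). field. apply Rgt_not_eq, Rpower_pos. }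
  rewrite E E2. pose proof (Rpower_pos r s). pose proof (Rpower_pos (k r / r) s).
  field. repeat split; lra.
- eapply lim_eq. apply lim_mult. lim. apply lim_inv. lim.
  apply Rgt_not_eq. now apply Rmult_lt_0_compat.
  field. lra.
Qed.

(** * From the hypotheses on [k] and [j] to the critical exponent *)

Lemma inverse_facts (k j : R -> R) (kmax : Rbar) :
  (forall r, 0 <= r -> 0 <= k r) -> increasing_on Rnonneg k ->
  inverse_functions Rnonneg (fun x => 0 <= x /\ Rbar_lt x kmax) k j ->
  Rbar_lt 0 kmax /\ (forall r, 0 < r -> 0 < k r) /\
  (forall x, 0 < x -> Rbar_lt x kmax -> 0 < j x /\ k (j x) = x) /\
  (forall r, 0 < r -> Rbar_lt (k r) kmax /\ j (k r) = r).
Proof.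
unfold increasing_on, Rnonneg. intros Hk Hinc [Hkj Hjk].
assert (Hkpos : forall r, 0 < r -> 0 < k r).
{ intros r Hr. apply Rle_lt_trans with (k 0). apply Hk; lra. apply Hinc; lra. }
assert (Hkm : forall r, 0 < r -> Rbar_lt (k r) kmax /\ j (k r) = r).
{ intros r Hr. destruct (Hkj r) as [[H1 H2] H3]; auto; lra. }
assert (Hkmax : Rbar_lt 0 kmax).
{ apply Rbar_lt_trans with (k 1). apply (Hkpos 1); lra. apply Hkm; lra. }
repeat split; trivial; try now apply Hkm.
- destruct (Hjk x) as [H1 H2]. split; trivial; lra.
  (* If [j x = 0] then [k 0 = x > 0]; but [k (j 0) = 0], a value that [k] would then take neither at
     0 nor at a positive point. *)
  destruct (Rle_lt_or_eq_dec _ _ H1) as [H3|H3]; trivial. exfalso.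
  rewrite -H3 in H2. destruct (Hjk 0) as [H4 H5]. split; trivial; lra.
  destruct (Rle_lt_or_eq_dec _ _ H4) as [H6|H6].
  + pose proof (Hkpos _ H6). lra.
  + rewrite -H6 in H5. lra.
- apply Hjk. split; trivial; lra.
Qed.

(* [(k r / r) * (r / c (k r))] tends both to [n] and to [(n / rho_c) * rho_c],
   which excludes [rho_c = 0] whatever the value of [n / 0]. *)
Lemma rho_c_pos (n : nat) (k j : R -> R) (kmax : Rbar) (rho_c : R) :
  (2 <= n)%nat ->
  (forall r, 0 <= r -> 0 <= k r) -> increasing_on Rnonneg k ->
  inverse_functions Rnonneg (fun x => 0 <= x /\ Rbar_lt x kmax) k j ->
  filterlim (fun x => j x / c n x) (at_right 0) (locally rho_c) ->
  filterlim (fun r => k r / r) (at_right 0) (locally (INR n / rho_c)) ->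
  0 < rho_c.
Proof.
intros Hn Hk Hinc Hinv Hl Hu.
assert (Hn' := two_le_INR n Hn).
destruct (inverse_facts k j kmax Hk Hinc Hinv) as [Hkmax [Hkpos [Hj Hkm]]].
assert (Hm := c_equivalent n Hn).
assert (Hm0 : 0 < 1 / INR n) by (apply Rdiv_lt_0_compat; lra).
assert (Hge : 0 <= rho_c).
{ apply (lim_ge (fun x => j x / c n x) rho_c 0 Hl).
  apply: filter_imp (filter_and _ _ (lim_eventually_pos _ _ Hm Hm0)
    (filter_and _ _ (at_right_pos 0) (at_right_lt_Rbar kmax Hkmax))).
  intros x [Hc [Hx Hxk]]. left. apply Rdiv_lt_0_compat. now apply Hj.
  replace (c n x) with (c n x / x * x) by (field; lra). now apply Rmult_lt_0_compat. }
destruct (Rle_lt_or_eq_dec _ _ Hge) as [H|H]; trivial. exfalso. symmetry in H.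
assert (Hk1 : at_right 0 (fun r => 0 < k r)).
{ apply: filter_imp (at_right_pos 0). exact Hkpos. }
pose proof (k_at_right_0 k _ Hk1 Hu) as Hk0.
pose proof (filterlim_comp _ _ _ k _ _ _ _ Hk0 Hl) as Hl'.
pose proof (filterlim_comp _ _ _ k _ _ _ _ Hk0 Hm) as Hm'. cbv beta in Hl', Hm'.
assert (H1 : filterlim (fun r => k r / r * (j (k r) / c n (k r)) * (c n (k r) / k r))
   (at_right 0) (locally 0)).
{ eapply lim_eq. lim. rewrite {2}H. ring. }
assert (H2 : filterlim (fun r => k r / r * (j (k r) / c n (k r)) * (c n (k r) / k r))
   (at_right 0) (locally 1)).
{ apply (filterlim_ext_loc (fun _ => 1)). 2: apply lim_const.
  apply: filter_imp (filter_and _ _ (at_right_pos 0) (lim_eventually_pos _ _ Hm' Hm0)).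
  intros r [Hr Hc]. rewrite (proj2 (Hkm r Hr)). field.
  pose proof (Hkpos r Hr). repeat split; try lra.
  intros Hc0. rewrite Hc0 /Rdiv Rmult_0_l in Hc. lra. }
pose proof (lim_unique _ _ _ H1 H2). lra.
Qed.

(** The common core of all cases. The limit of (j / c - rho_c) / r^s is [rho_c] times the quantity
    assumed nonzero, so its positivity follows from [j / c > rho_c]. *)
Lemma critical_exponent_of_expansion
  (n : nat) (k j : R -> R) (kmax : Rbar) (rho_c s e a B : R) :
  (2 <= n)%nat ->
  (forall r, 0 <= r -> 0 <= k r) -> increasing_on Rnonneg k ->
  inverse_functions Rnonneg (fun x => 0 <= x /\ Rbar_lt x kmax) k j ->
  (forall x, 0 < x -> Rbar_lt x kmax ->
     ex_derive (fun x => j x / c n x) x /\ 0 < Derive (fun x => j x / c n x) x) ->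
  filterlim (fun x => j x / c n x) (at_right 0) (locally rho_c) ->
  0 < rho_c -> 0 < s < 4 ->
  filterlim (fun r => k r / r) (at_right 0) (locally (INR n / rho_c)) ->
  filterlim (fun r => (k r / r - (INR n / rho_c + e * r ^ 2)) / Rpower r s)
    (at_right 0) (locally (- a)) ->
  filterlim (fun r => (rho_c / (INR n ^ 2 * (INR n + 2)) * (k r / r) ^ 3
      - rho_c / INR n * e) * Rpower r (2 - s)) (at_right 0) (locally B) ->
  rho_c * a / INR n + B <> 0 ->
  0 < rho_c * a / INR n + B /\
  is_critical_exponent (order_parameter n j kmax rho_c) rho_c (1 / s).
Proof.
intros Hn Hk Hinc Hinv Hd Hl Hrc Hs Hu Hw HB HA.
destruct (inverse_facts k j kmax Hk Hinc Hinv) as [Hkmax [Hkpos [Hj Hkm]]].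
assert (Hk1 : at_right 0 (fun r => 0 < k r)).
{ apply: filter_imp (at_right_pos 0). exact Hkpos. }
pose proof (ratio_expansion n k rho_c s e a B Hn Hrc (proj2 Hs) Hk1 Hu Hw HB) as Hr.
assert (HApos : 0 < rho_c * a / INR n + B).
{ assert (H : 0 <= rho_c * (rho_c * a / INR n + B)).
  { apply (lim_ge _ _ 0 Hr). apply: filter_imp (at_right_pos 0). intros r Hr0.
    destruct (Hkm r Hr0) as [H1 H2].
    pose proof (ratio_gt_limit _ kmax rho_c Hd Hl (k r) (Hkpos r Hr0) H1) as H3.
    cbv beta in H3. rewrite H2 in H3. left. apply Rdiv_lt_0_compat. lra.
    apply Rpower_pos. }
  destruct (Rtotal_order 0 (rho_c * a / INR n + B)) as [H0|[H0|H0]]; trivial.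
  now symmetry in H0. exfalso. nra. }
split; trivial.
apply (order_parameter_exponent n j kmax rho_c s (rho_c * (rho_c * a / INR n + B)));
  trivial; try lra.
- now apply Rmult_lt_0_compat.
- intros x Hx Hxk. now apply Hj.
- apply kappa_of_small; trivial. lra. intros x Hx Hxk. now apply Hj.
- assert (Hsmall : at_right 0 (fun x => 0 < x /\ Rbar_lt x kmax)).
  { apply filter_and. apply at_right_pos. now apply at_right_lt_Rbar. }
  assert (Hm := c_equivalent n Hn).
  assert (Hm0 : at_right 0 (fun x => 0 < c n x / x)).
  { apply (lim_eventually_pos _ _ Hm). apply Rdiv_lt_0_compat. lra.
    apply lt_0_INR. lia. }
  (* Writing j x = (j x / c x)(c x / x) x gives j -> 0 from known limits; this is what allows
     substituting [r = j x] in the expansion in [r]. *)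
  assert (Hj0 : filterlim j (at_right 0) (at_right 0)).
  { apply lim_at_right.
    - apply (filterlim_ext_loc (fun x => j x / c n x * (c n x / x) * x)).
      + apply: filter_imp (filter_and _ _ Hsmall Hm0). intros x [[Hx _] Hc].
        field. split; [lra|]. intros H0. rewrite H0 /Rdiv Rmult_0_l in Hc. lra.
      + eapply lim_eq. lim. ring.
    - apply: filter_imp Hsmall. intros x [Hx Hxk]. now apply Hj. }
  pose proof (filterlim_comp _ _ _ j _ _ _ _ Hj0 Hr) as H. cbv beta in H.
  refine (filterlim_ext_loc _ _ _ H).
  apply: filter_imp Hsmall. intros x [Hx Hxk]. now rewrite (proj2 (Hj x Hx Hxk)).
Qed.

Lemma expansion_coefficient (f h : R -> R) (a s : R) :
  expansion_at_0 f (fun r => h r - a * Rpower r s) s ->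
  filterlim (fun r => (f r - h r) / Rpower r s) (at_right 0) (locally (- a)).
Proof.
intros Hexp.
assert (Hpow : at_right 0 (fun r => 0 < Rpower r s)).
{ apply filter_forall. intros. apply Rpower_pos. }
pose proof (domin_lim _ _ Hpow Hexp) as H. cbv beta in H.
apply (filterlim_ext_loc (fun r => (f r - (h r - a * Rpower r s)) / Rpower r s + - a)).
- apply: filter_imp Hpow. intros r Hr. field. lra.
- eapply lim_eq. lim. ring.
Qed.

Theorem proposition4p2 :
  forall (n : nat) (nu tau k k' j : R -> R) (kmax : Rbar) (rho_c : R),
  (2 <= n)%nat ->
  (forall r : R, 0 <= r -> 0 <= nu r) ->
  (forall r : R, 0 <= r -> 0 < tau r) ->
  lipschitz_on Rpositive (fun r => nu r / r) ->
  bounded_on Rpositive (fun r => nu r / r) ->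
  lipschitz_on Rnonneg tau ->
  bounded_on Rnonneg tau ->
  (forall r : R, 0 <= r -> k r = nu r / tau r) ->
  increasing_on Rnonneg k ->
  is_lim k p_infty kmax ->
  inverse_functions Rnonneg (fun kappa => 0 <= kappa /\ Rbar_lt kappa kmax)
    k j ->
  (forall r : R, 0 <= r -> is_derive_within Rnonneg k r (k' r)) ->
  lipschitz_on Rnonneg k' ->
  (forall kappa : R, 0 < kappa -> Rbar_lt kappa kmax ->
     ex_derive (fun x => j x / c n x) kappa /\
     0 < Derive (fun x => j x / c n x) kappa) ->
  (* the critical density is finite *)
  filterlim (fun kappa => j kappa / c n kappa) (at_right 0) (locally rho_c) ->
  forall q a : R,
  1 <= q ->
  expansion_at_0 (fun r => k r / r)
    (fun r => INR n / rho_c - a * Rpower r q) q ->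
  let alpha := order_parameter n j kmax rho_c in
  let a_crit := - (INR n ^ 2 / (rho_c ^ 3 * (INR n + 2))) in
  (q < 2 -> a <> 0 ->
     0 < a /\ is_critical_exponent alpha rho_c (1 / q)) /\
  (2 < q -> is_critical_exponent alpha rho_c (1 / 2)) /\
  ((q = 2 -> a <> a_crit ->
      a_crit < a /\ is_critical_exponent alpha rho_c (1 / 2)) /\
   (forall p a2 : R,
      2 < p < 4 -> a2 <> 0 ->
      expansion_at_0 (fun r => k r / r)
        (fun r => INR n / rho_c
                  + INR n ^ 2 / (rho_c ^ 3 * (INR n + 2)) * r ^ 2
                  - a2 * Rpower r p) p ->
      0 < a2 /\ is_critical_exponent alpha rho_c (1 / p))).
Proof.
intros n nu tau k k' j kmax rho_c Hn Hnu Htau _ _ _ _ Hk Hinc _ Hinv _ _ Hd Hl q a Hq Hexp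
  alpha a_crit.
assert (Hn' := two_le_INR n Hn).
assert (Hk0 : forall r, 0 <= r -> 0 <= k r).
{ intros r Hr. rewrite Hk //. apply Rmult_le_pos. now apply Hnu.
  left. apply Rinv_0_lt_compat. now apply Htau. }
assert (Hpow : forall s, at_right 0 (fun r => 0 < Rpower r s)).
{ intros s. apply filter_forall. intros. apply Rpower_pos. }
assert (Hw : filterlim (fun r => (k r / r - (INR n / rho_c + 0 * r ^ 2)) / Rpower r q)
  (at_right 0) (locally (- a))).
{ refine (filterlim_ext _ _ _ (expansion_coefficient _ (fun _ => INR n / rho_c) a q Hexp)).
  intros r. cbv beta. now rewrite Rmult_0_l Rplus_0_r. }
assert (Hu : filterlim (fun r => k r / r) (at_right 0) (locally (INR n / rho_c))).
{ apply (filterlim_ext_loc (fun r =>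
    (k r / r - (INR n / rho_c + 0 * r ^ 2)) / Rpower r q * Rpower r q + INR n / rho_c)).
  - apply: filter_imp (Hpow q). intros r Hr. unfold Rdiv at 1.
    rewrite Rmult_assoc Rinv_l; [ring|lra].
  - pose proof (lim_Rpower_0 q ltac:(lra)) as H. eapply lim_eq. lim. ring. }
assert (Hrc := rho_c_pos n k j kmax rho_c Hn Hk0 Hinc Hinv Hl Hu).
assert (Hmain := fun s e a' B => critical_exponent_of_expansion n k j kmax rho_c s e a' B
  Hn Hk0 Hinc Hinv Hd Hl Hrc).
fold alpha in Hmain.
assert (Hpos : 0 < rho_c / INR n) by (apply Rdiv_lt_0_compat; lra).
(* For s = 2 and e = 0 the limit [B] is the contribution of the cubic term of [c] alone; divided by
   rho_c / n it equals [- a_crit]. *)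
assert (HB2 : filterlim (fun r => (rho_c / (INR n ^ 2 * (INR n + 2)) * (k r / r) ^ 3
      - rho_c / INR n * 0) * Rpower r (2 - 2)) (at_right 0)
      (locally (INR n / (rho_c ^ 2 * (INR n + 2))))).
{ apply (filterlim_ext_loc (fun r => rho_c / (INR n ^ 2 * (INR n + 2)) * (k r / r) ^ 3)).
  - apply: filter_imp (at_right_pos 0). intros r Hr.
    replace (2 - 2) with 0 by ring. rewrite Rpower_O //. ring.
  - eapply lim_eq. lim. field. lra. }
assert (E : forall x, rho_c * x / INR n + 0 = rho_c / INR n * x) by (intros; field; lra).
split; [|split; [|split]].
- intros Hq2 Ha.
  (* The order is s = q < 2: the r^2 contributions carry a factor r^(2 - q) and disappear, so
     [B = 0]. *)
  destruct (Hmain q 0 a 0) as [H1 H2]; trivial; try lra.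
  + eapply lim_eq. apply lim_mult. lim. apply lim_Rpower_0. lra. ring.
  + rewrite E. apply Rmult_integral_contrapositive_currified; [lra|trivial].
  + split; trivial. rewrite E in H1. apply Rmult_lt_reg_l with (1 := Hpos). now rewrite Rmult_0_r.
- intros Hq2.
  (* The order is s = 2 with coefficient 0: the term in r^q is o(r^2), and the positive coefficient
     comes entirely from [c]. *)
  destruct (Hmain 2 0 0 (INR n / (rho_c ^ 2 * (INR n + 2)))) as [H1 H2]; trivial; try lra.
  + apply (filterlim_ext_loc (fun r =>
      (k r / r - (INR n / rho_c + 0 * r ^ 2)) / Rpower r q * Rpower r (q - 2))).
    * apply: filter_imp (at_right_pos 0). intros r Hr. rewrite (Rpower_split r q 2).
      field. pose proof (Rpower_pos r 2). pose proof (Rpower_pos r (q - 2)).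
      repeat split; lra.
    * pose proof (lim_Rpower_0 (q - 2) ltac:(lra)) as H. eapply lim_eq. lim. ring.
  + replace (rho_c * 0 / INR n) with 0 by (field; lra). rewrite Rplus_0_l.
    apply Rgt_not_eq. apply Rdiv_lt_0_compat. lra.
    apply Rmult_lt_0_compat; [|lra]. now apply pow_lt.
- intros -> Ha.
  assert (E2 : rho_c * a / INR n + INR n / (rho_c ^ 2 * (INR n + 2)) =
    rho_c / INR n * (a - a_crit)) by (unfold a_crit; field; lra).
  destruct (Hmain 2 0 a (INR n / (rho_c ^ 2 * (INR n + 2)))) as [H1 H2]; trivial; try lra.
  + rewrite E2. apply Rmult_integral_contrapositive_currified; [lra|now apply Rminus_eq_contra].
  + split; trivial. rewrite E2 in H1.
    apply Rmult_lt_reg_l with (1 := Hpos). lra.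
- intros p a2 Hp Ha2 Hexp2.
  (* This [e] is [- a_crit], and (rho_c / n) e = rho_c (n / rho_c)^3 / (n^2 (n + 2)). The r^2
     contributions thus reduce to a multiple of u^3 - (n / rho_c)^3 = O(r^2), which times r^(2 - p)
     is O(r^(4 - p)); hence [B = 0]. *)
  set (e := INR n ^ 2 / (rho_c ^ 3 * (INR n + 2))) in *.
  assert (Hw2 : filterlim (fun r => (k r / r - (INR n / rho_c + e * r ^ 2)) / Rpower r p)
    (at_right 0) (locally (- a2))).
  { exact (expansion_coefficient _ (fun r => INR n / rho_c + e * r ^ 2) a2 p Hexp2). }
  destruct (Hmain p e a2 0) as [H1 H2]; trivial; try lra.
  + (* [u - n / rho_c = e r^2 + w] is factored out of [u^3 - (n / rho_c)^3] *)
    apply (filterlim_ext_loc (fun r => rho_c / (INR n ^ 2 * (INR n + 2)) *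
      (e * Rpower r (4 - p)
       + (k r / r - (INR n / rho_c + e * r ^ 2)) / Rpower r p * r ^ 2) *
      ((k r / r) ^ 2 + k r / r * (INR n / rho_c) + (INR n / rho_c) ^ 2))).
    * apply: filter_imp (at_right_pos 0). intros r Hr.
      pose proof (Rpower_pos r p).
      replace (Rpower r (4 - p)) with (r ^ 4 / Rpower r p).
      2: { rewrite -(Rpower_pow 4 r) //. replace (INR 4) with 4 by (simpl; ring).
           rewrite (Rpower_split r 4 p). field. lra. }
      replace (Rpower r (2 - p)) with (r ^ 2 / Rpower r p).
      2: { rewrite -(Rpower_pow 2 r) //. replace (INR 2) with 2 by (simpl; ring).
           rewrite (Rpower_split r 2 p). field. lra. }
      unfold e. field. repeat split; lra.
    * pose proof (lim_Rpower_0 (4 - p) ltac:(lra)) as H. eapply lim_eq. lim. ring.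
  + rewrite E. apply Rmult_integral_contrapositive_currified; [lra|trivial].
  + split; trivial. rewrite E in H1. apply Rmult_lt_reg_l with (1 := Hpos). now rewrite Rmult_0_r.
Qed.
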